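(* Let $R$ be a basic finite dimensional algebra over an algebraically closed field $K$ with complete set of orthogonal primitive idempotents $\{e_1,\dots,e_m\}$, let $n_1,\dots,n_m\ge 1$ be natural numbers, and let $P=R(n_1,\dots,n_m)$ be the block extension of $R$. Let $d_{is}$ be the number of arrows from $i$ to $s$ in the quiver $Q$ of $R$. Then the quiver $Q'$ of $P$ (with the vertex $(i,j)$ corresponding to the primitive idempotent $f_{ij}$ of $P$) is given as follows. (a) The set of vertices of $Q'$ is $\{(i,j)\mid 1\le i\le m,\ 1\le j\le n_i\}$. (b) The arrows of $Q'$ are exactly of the following two kinds: for each $1\le i\le m$ and $1\le j\le n_i-1$, one arrow $\delta_{ij}$ from $(i,j)$ to $(i,j+1)$; and for each $1\le i,s\le m$, $d_{is}$ arrows $\beta^1_{is},\beta^2_{is},\dots,\beta^{d_{is}}_{is}$ from $(i,n_i)$ to $(s,1)$.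
   Context: Algebras are finite dimensional associative unital algebras over an algebraically closed field $K$; $J(-)$ denotes the Jacobson radical. $R$ is basic if the modules $e_iR$ are pairwise non-isomorphic. Quiver of an algebra: for a basic algebra $B$ with complete set of orthogonal primitive idempotents $\{g_a\}_a$, the quiver of $B$ has vertices the indices $a$ and has $\dim_K g_a\big(J(B)/J(B)^2\big)g_b$ arrows from $a$ to $b$. For $R$, put $Q_i=e_iRe_i$ and $A_{ij}=e_iRe_j$ for $i\ne j$. Put $X_{ii}=J(Q_i)^2+\sum_{k\ne i}A_{ik}A_{ki}$ and, for $i\neq j$, $X_{ij}=J(Q_i)A_{ij}+A_{ij}J(Q_j)+\sum_{k\ne i,j}A_{ik}A_{kj}$, so that $X_{ij}=e_iJ(R)^2e_j$. The number of arrows of the quiver $Q$ of $R$ (with vertices $1,\dots,m$) from $i$ to $j$ is $d_{ij}$, where $d_{ii}=\dim_K J(Q_i)/X_{ii}$ and $d_{ij}=\dim_K A_{ij}/X_{ij}$ for $i\ne j$. Block extension: for $1\le i,s\le m$, $1\le j\le n_i$, $1\le t\le n_s$ put $P_{ij,st}=Q_i$ if $i=s$ and $j\le t$; $P_{ij,st}=J(Q_i)$ if $i=s$ and $j>t$; $P_{ij,st}=A_{is}$ if $i\ne s$. The block extension $P=R(n_1,\dots,n_m)$ is the algebra of all matrices with rows and columns indexed by the pairs $(i,j)$, $1\le i\le m$, $1\le j\le n_i$, whose $(ij,st)$-entry lies in $P_{ij,st}$, with the usual matrix multiplication (using the multiplication of $R$). It is a basic finite dimensional $K$-algebra with complete set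 of orthogonal primitive idempotents $\{f_{ij}\}$, where $f_{ij}$ is the matrix with $(ij,ij)$-entry $e_i$ (the identity of $Q_i$) and all other entries $0$. *)

(* Defs.v *)
From HB Require Import structures.
From mathcomp Require Import all_boot all_order all_algebra all_field.
From mathcomp Require Import boolp.

Set Implicit Arguments.
Unset Strict Implicit.
Unset Printing Implicit Defensive.

Import GRing.Theory.
Local Open Scope ring_scope.

(* A subalgebra of A with an identity element that may differ from 1, such as *)
(* e A e, is handled as a subspace U of A. Since K times the identity of U    *)
(* lies in U, the right ideals of U are automatically subspaces.              *)
Section Algebra.
Variables (K : fieldType) (A : falgType K).
Implicit Types (U V : {vspace A}) (e f g : A).

Definition right_ideal U V : Prop := (V <= U)%VS /\ (V * U <= V)%VS.

Definition maximal_right_ideal U V : Prop :=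
  [/\ right_ideal U V, V <> U &
      forall W, right_ideal U W -> (V <= W)%VS -> W = V \/ W = U].

Lemma ex_bigcapv (F : {vspace A} -> Prop) :
  exists W : {vspace A}, forall x, x \in W <-> forall V, F V -> x \in V.
Proof.
pose G (W : {vspace A}) := forall x, (forall V, F V -> x \in V) -> x \in W.
suff: forall d (W : {vspace A}), (\dim W <= d)%N -> G W ->
    exists W : {vspace A}, forall x, x \in W <-> forall V, F V -> x \in V.
  by apply; [apply: leqnn | move=> x _; apply: memvf].
elim=> [|d IHd] W dW GW.
  exists W => x; split=> [xW V _|]; last exact: GW.
  by move: dW xW; rewrite leqn0 dimv_eq0 => /eqP->; rewrite memv0 => /eqP->; rewrite mem0v.
have [sWF|nsWF] := pselect (forall V, F V -> (W <= V)%VS).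
  by exists W => x; split=> [xW V /sWF/subvP/(_ x xW)|]; last exact: GW.
have [V [FV nWV]] : exists V, F V /\ ~~ (W <= V)%VS.
  apply: contrapT => nex; apply: nsWF => V FV.
  by apply/negPn/negP => nWV; apply: nex; exists V.
apply: (IHd (W :&: V)%VS) => [|x xF]; last by rewrite memv_cap GW ?xF.
rewrite -ltnS (leq_trans _ dW) // (ltn_leqif (dimv_leqif_sup (capvSl W V))).
by apply: contra nWV => /subvP sWV; apply/subvP=> x /sWV; rewrite memv_cap => /andP[].
Qed.

Definition bigcapv (F : {vspace A} -> Prop) : {vspace A} :=
  sval (cid (ex_bigcapv F)).

Lemma mem_bigcapv (F : {vspace A} -> Prop) x :
  x \in bigcapv F <-> forall V, F V -> x \in V.
Proof. exact: (svalP (cid (ex_bigcapv F))). Qed.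

Definition jacobson U : {vspace A} := (U :&: bigcapv (maximal_right_ideal U))%VS.

Lemma mem_jacobson U x :
  x \in jacobson U <->
  x \in U /\ forall V, maximal_right_ideal U V -> x \in V.
Proof.
rewrite memv_cap; split=> [/andP[-> /mem_bigcapv] //|[-> xV]].
exact/mem_bigcapv.
Qed.

(* e U f *)
Definition corner e U f : {vspace A} := (<[e]> * U * <[f]>)%VS.

Definition primitive_idempotent e : Prop :=
  [/\ e * e = e, e != 0 &
      forall f g, f * f = f -> g * g = g -> f * g = 0 -> g * f = 0 ->
        e = f + g -> f = 0 \/ g = 0].

Definition complete_primitive_idempotents (I : finType) (e : I -> A) : Prop :=
  [/\ forall i, primitive_idempotent (e i),
      forall i j, i != j -> e i * e j = 0 &
      \sum_i e i = 1].

(* U and V are isomorphic right A-submodules of A; a linear map defined on U  *)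
(* always extends to A.                                                       *)
Definition right_module_iso U V : Prop :=
  exists phi : 'End(A),
    [/\ {in U &, injective phi}, (phi @: U)%VS = V &
        {in U, forall x a, phi (x * a) = phi x * a}].

Definition basic (I : finType) (e : I -> A) : Prop :=
  forall i j, right_module_iso (<[e i]> * fullv)%VS (<[e j]> * fullv)%VS -> i = j.

(* The dimension of e_i (J / J^2) e_j, the subspace (e_i J e_j + J^2) / J^2   *)
(* of J / J^2.                                                                *)
Definition num_arrows (I : finType) (e : I -> A) (i j : I) : nat :=
  let J := jacobson fullv in
  (\dim (corner (e i) J (e j) + J * J)%VS - \dim (J * J)%VS)%N.

End Algebra.

Record quiver := Quiver {
  vertex : finType;
  arrow : finType;
  source : arrow -> vertex;
  target : arrow -> vertex }.

(* Q is the quiver of the basic algebra A, with vertex i corresponding to the *)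
(* primitive idempotent e i.                                                  *)
Definition is_quiver_of (K : fieldType) (A : falgType K) (Q : quiver)
    (e : vertex Q -> A) : Prop :=
  [/\ complete_primitive_idempotents e, basic e &
      forall i j : vertex Q,
        #|[set a : arrow Q | (source a == i) && (target a == j)]| =
        num_arrows e i j].
Arguments is_quiver_of {K A} Q e.

Section Facts.
Variables (K : fieldType) (A : falgType K).
Implicit Types (U V : {vspace A}) (e f g : A).

Lemma mem_corner e f x : e * e = e -> f * f = f ->
  x \in corner e fullv f <-> e * x * f = x.
Proof.
move=> ee ff; split=> [|<-]; last by rewrite !memv_mul ?memv_line ?memvf.
pose h := ((amulr f \o amull e)%VF - \1%VF).
have hE y : (y \in lker h) = (e * y * f == y).
  by rewrite memv_ker !lfun_simp /= subr_eq0.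
have sub : (corner e fullv f <= lker h)%VS.
  rewrite /corner -prodvA; apply/prodvP => _ y /vlineP[k ->] yP.
  have: y \in lker (amulr f - \1%VF).
    apply: subvP y yP; apply/prodvP => z _ _ /vlineP[l ->].
    by rewrite memv_ker !lfun_simp /= -!scalerAr -scalerAl -mulrA ff subrr.
  rewrite memv_ker !lfun_simp /= subr_eq0 hE => /eqP yf.
  by rewrite -!scalerAl -!scalerAr -!scalerAl -!mulrA yf mulrA ee.
by move/(subvP sub); rewrite hE => /eqP.
Qed.

Lemma jacobson_sub U : (jacobson U <= U)%VS.
Proof. exact: capvSl. Qed.

Lemma amullE (u x : A) : amull u x = u * x.
Proof. exact: lfunE. Qed.

Lemma jacobson_mulr U x u : (U * U <= U)%VS ->
  x \in jacobson U -> u \in U -> x * u \in jacobson U.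
Proof.
move=> UU /mem_jacobson[xU xV] uU; apply/mem_jacobson; split.
  by apply: (subvP UU); rewrite memv_mul.
move=> V maxV; have [[_ VU] _ _] := maxV.
by apply: (subvP VU); rewrite memv_mul ?xV.
Qed.

Lemma jacobson_mull U x u : (U * U <= U)%VS ->
  x \in jacobson U -> u \in U -> u * x \in jacobson U.
Proof.
move=> UU /mem_jacobson[xU xV] uU; apply/mem_jacobson; split.
  by apply: (subvP UU); rewrite memv_mul.
move=> M maxM; have [[MsU MU] nMU Mmax] := maxM.
have uE z V : (z \in (amull u @^-1: V)%VS) = (u * z \in V).
  by rewrite -memv_preim amullE.
pose V := (U :&: amull u @^-1: M)%VS.
have VU : right_ideal U V.
  split; first exact: capvSl.
  apply/prodvP => y z; rewrite memv_cap uE => /andP[yU uyM] zU.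
  rewrite memv_cap uE mulrA (subvP UU) ?memv_mul //=.
  by apply: (subvP MU); rewrite memv_mul.
have [eqVU|neVU] := EM (V = U).
  by move: xU; rewrite -{1}eqVU memv_cap uE => /andP[].
suff: x \in V by rewrite memv_cap uE => /andP[].
apply: xV; split=> // W WU sVW; have [sWU WUW] := WU.
have uW_ideal : right_ideal U (M + amull u @: W)%VS.
  split.
    rewrite subv_add MsU; apply/subvP => _ /memv_imgP[w wW ->].
    by rewrite amullE (subvP UU) // memv_mul // (subvP sWU).
  rewrite prodvDl subv_add (subv_trans MU) ?addvSl //=.
  apply/prodvP => _ z /memv_imgP[w wW ->] zU.
  rewrite amullE -mulrA (subvP (addvSr _ _)) //; apply/memv_imgP.
  by exists (w * z); rewrite ?amullE // (subvP WUW) // memv_mul.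
have [eqM|eqU] := Mmax _ uW_ideal (addvSl _ _); [left|right].
  apply/eqP; rewrite eqEsubv sVW andbT; apply/subvP => w wW.
  rewrite memv_cap uE (subvP sWU) //= -eqM (subvP (addvSr _ _)) //.
  by apply/memv_imgP; exists w; rewrite ?amullE.
apply/eqP; rewrite eqEsubv sWU; apply/subvP => y yU.
have: u * y \in U by rewrite (subvP UU) // memv_mul.
rewrite -{1}eqU => /memv_addP[m mM [_ /memv_imgP[w wW ->]]].
rewrite amullE => uyE; rewrite -(subrK w y) rpredD // (subvP sVW) //.
by rewrite memv_cap uE mulrBr uyE addrK mM rpredB // (subvP sWU).
Qed.

(* Fitting's lemma for the corner e A e of a primitive idempotent e. *)
Lemma fitting e x : primitive_idempotent e -> e * x * e = x ->
  exists y, e * y * e = y /\ (x * y = e \/ (e - x) * y = e).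
Proof.
move=> [ee e0 prim] exe.
have ex : e * x = x by rewrite -[in LHS]exe !mulrA ee exe.
have xe : x * e = x by rewrite -[in LHS]exe -mulrA ee exe.
have xXe k : e * x ^+ k.+1 = x ^+ k.+1 by rewrite exprS mulrA ex.
have xXr k : x ^+ k.+1 * e = x ^+ k.+1 by rewrite exprSr -mulrA xe.
have [k [z [cxz xk]]] : exists k z, x * z = z * x /\ x ^+ k.+1 = x ^+ k.+2 * z.
  pose d := \dim {:A}.
  pose X := [tuple x ^+ i | i < d.+1].
  have nfree : ~~ free X.
    apply/negP => /eqP eqd; have := dimvS (subvf <<X>>%VS).
    by rewrite eqd size_tuple ltnn.
  have [c c0 [i0 ci0]] : exists2 c : 'I_d.+1 -> K,
      \sum_i c i *: x ^+ i = 0 & exists i, c i != 0.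
    apply: contrapT => nex; case/negP: nfree; apply/freeP => c c0 i.
    apply: contrapT => /eqP ci; apply: nex; exists c; last by exists i.
    by rewrite -[RHS]c0; apply: eq_bigr => j _; rewrite -tnth_nth tnth_mktuple.
  case: (@arg_minnP _ i0 (fun i => c i != 0) (fun i => nat_of_ord i) ci0) => k ck kmin.
  pose z := - (c k)^-1 *: \sum_(i < d.+1 | (k < i)%N) c i *: x ^+ (i - k.+1).
  exists k, z; have czx : x * z = z * x.
    rewrite /z -scalerAr -scalerAl mulr_sumr mulr_suml; congr (_ *: _).
    by apply: eq_bigr => i _; rewrite -scalerAr -scalerAl commrX.
  split=> //; rewrite [LHS]exprS [in RHS]exprS -mulrA; congr (x * _).
  rewrite /z -scalerAr; apply: (scalerI ck); rewrite scalerA mulrN divff // scaleN1r.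
  apply/eqP; rewrite -subr_eq0 opprK -[X in _ == X]c0 [X in _ == X](bigD1 k) //=; apply/eqP; congr (_ + _).
  rewrite mulr_sumr [RHS](bigID (fun i : 'I_d.+1 => (k < i)%N)) /= [X in _ = _ + X]big1.
    rewrite addr0; apply: eq_big => [i|i ki].
      by case: ltngtP => [||/val_inj ->] //=; rewrite ?andbF ?eqxx // => ki; rewrite andbT; apply/esym/eqP => eki; rewrite eki ltnn in ki.
    by rewrite -scalerAr -exprD subnKC.
  move=> i /andP[nik]; rewrite -leqNgt => ik.
  have [->|/kmin ki] := eqVneq (c i) 0; first by rewrite scale0r.
  by case/eqP: nik; apply/val_inj/eqP; rewrite eqn_leq ik ki.
have cX n : x * z ^+ n = z ^+ n * x by apply: commrX.
have xkz n : x ^+ k.+1 = x ^+ k.+1 * (x * z) ^+ n.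
  elim: n => [|n IHn]; first by rewrite mulr1.
  by rewrite [(x * z) ^+ n.+1]exprS mulrA [x ^+ k.+1 * _]mulrA -exprSr -xk.
have cxz' : GRing.comm x (x * z) by rewrite /GRing.comm -mulrA -cxz.
pose g := (x * z) ^+ k.+1.
have gE : g = x ^+ k.+1 * z ^+ k.+1 by rewrite /g exprMn_comm.
have gE' : g = z ^+ k.+1 * x ^+ k.+1.
  by rewrite gE; apply/commrX/commr_sym/commrX/commr_sym.
have xg : x ^+ k.+1 * g = x ^+ k.+1 by rewrite [RHS](xkz k.+1).
have gg : g * g = g by rewrite {1}gE' -mulrA xg -gE'.
have eg : e * g = g by rewrite gE mulrA xXe.
have ge : g * e = g by rewrite gE' -mulrA xXr.
have [|||||g0|h0] := prim g (e - g).
- exact: gg.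
- by rewrite mulrBl !mulrBr ee eg ge gg subrr subr0.
- by rewrite mulrBr ge gg subrr.
- by rewrite mulrBl eg gg subrr.
- by rewrite addrC subrK.
- have x0 : x ^+ k.+1 = 0 by rewrite (xkz k.+1) -/g g0 mulr0.
  exists (e * (\sum_(i < k.+1) x ^+ i) * e); split; first by rewrite !mulrA ee -!mulrA ee.
  have geom : (1 - x) * (\sum_(i < k.+1) x ^+ i) = 1.
    have := subrX1 x k.+1; rewrite x0 sub0r => /(congr1 -%R).
    by rewrite opprK -mulNr opprB.
  have exe1 : (e - x) * e = e * (1 - x) by rewrite mulrBl mulrBr mulr1 ee xe ex.
  by right; rewrite !mulrA exe1 -[e * _ * _]mulrA geom mulr1 ee.
- have {h0} eqg : e = g by apply/eqP; rewrite -subr_eq0 h0.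
  exists (e * (z * (x * z) ^+ k) * e); split; first by rewrite !mulrA ee -!mulrA ee.
  by left; rewrite !mulrA xe -[x * z * _]exprS -/g ge eqg.
Qed.

Lemma corner_product e e' x y : primitive_idempotent e -> primitive_idempotent e' ->
  ~ right_module_iso (<[e]> * fullv)%VS (<[e']> * fullv)%VS ->
  x \in corner e fullv e' -> y \in corner e' fullv e ->
  x * y \in jacobson (corner e fullv e).
Proof.
move=> pe pe' niso; have [[ee e0 _] [ee' e0' prim']] := (pe, pe').
move=> /mem_corner-/(_ ee ee') xE /mem_corner-/(_ ee' ee) yE.
have ex : e * x = x by rewrite -[in LHS]xE !mulrA ee xE.
have xe : x * e' = x by rewrite -[in LHS]xE -mulrA ee' xE.
have ey : e' * y = y by rewrite -[in LHS]yE !mulrA ee' yE.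
have ye : y * e = y by rewrite -[in LHS]yE -mulrA ee yE.
have memQ z : z \in corner e fullv e <-> e * z * e = z by apply: mem_corner.
apply/mem_jacobson; split; first by apply/memQ; rewrite mulrA ex -mulrA ye.
move=> M [[sMQ MQ] nMQ Mmax]; apply: contrapT => nxyM; apply: nMQ.
have QQ : (corner e fullv e * corner e fullv e <= corner e fullv e)%VS.
  apply/prodvP => a b /memQ <- /memQ <-; apply/memQ.
  by rewrite !mulrA ee -!mulrA ee.
have xyQ : x * y \in corner e fullv e by apply/memQ; rewrite mulrA ex -mulrA ye.
have eQ : e \in corner e fullv e by apply/memQ; rewrite !ee.
pose N := (M + amull (x * y) @: corner e fullv e)%VS.
have idN : right_ideal (corner e fullv e) N.
  split.
    rewrite subv_add sMQ; apply/subvP => _ /memv_imgP[z zQ ->].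
    by rewrite amullE (subvP QQ) // memv_mul.
  rewrite prodvDl; apply: addvS => //.
  apply/prodvP => _ z /memv_imgP[w wQ ->] zQ; apply/memv_imgP.
  by exists (w * z); rewrite ?amullE ?mulrA // (subvP QQ) // memv_mul.
have [NM|NQ] := Mmax N idN (addvSl _ _).
  case: nxyM; rewrite -NM (subvP (addvSr _ _)) //; apply/memv_imgP.
  by exists e; rewrite // amullE -mulrA ye.
move: (eQ); rewrite -{1}NQ => /memv_addP[a aM [_ /memv_imgP[z /memQ zE ->]]].
rewrite amullE => eE.
have [w [wE [xyzw|aw]]] : exists w, e * w * e = w /\
    (x * y * z * w = e \/ (e - x * y * z) * w = e).
  apply: fitting => //; rewrite !mulrA ex -[in LHS]zE !mulrA.
  by rewrite -[X in X = _]mulrA ee -[RHS]mulrA -[z in RHS]zE !mulrA.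
- case: niso; pose u := e' * y * z * w * e.
  have xu : x * u = e by rewrite /u !mulrA xe xyzw ee.
  have eu : e' * u = u by rewrite /u !mulrA ee'.
  have ue : u * e = u by rewrite /u -mulrA ee.
  clearbody u.
  have uxux : u * x * (u * x) = u * x by rewrite mulrA -[u * x * u]mulrA xu ue.
  have eux : e' * (u * x) = u * x by rewrite mulrA eu.
  have uxe : u * x * e' = u * x by rewrite -mulrA xe.
  have ux : u * x = e'.
    have [||||ux0|/eqP] := prim' (u * x) (e' - u * x) uxux.
    - by rewrite mulrBl !mulrBr ee' eux uxe uxux subrr subr0.
    - by rewrite mulrBr uxe uxux subrr.
    - by rewrite mulrBl eux uxux subrr.
    - by rewrite addrC subrK.
    - by case/eqP: e0; rewrite -ee -{1}xu -xu mulrA -[x * u * x]mulrA ux0 mulr0 mul0r.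
    - by rewrite subr_eq0 => /eqP.
  have memR f v : f * f = f -> v \in (<[f]> * fullv)%VS <-> f * v = v.
    move=> ff; split=> [|<-]; last by rewrite memv_mul ?memv_line ?memvf.
    suff: (<[f]> * fullv <= lker (amull f - \1%VF))%VS.
      move/subvP => sub /sub; rewrite memv_ker !lfun_simp /= subr_eq0.
      by move/eqP.
    apply/prodvP => _ b /vlineP[k ->] _.
    by rewrite memv_ker !lfun_simp /= -scalerAl -scalerAr mulrA ff subrr.
  exists (amull u); split.
  - move=> b b' /(memR _ _ ee) <- /(memR _ _ ee) <-; rewrite !amullE.
    by move/(congr1 ( *%R x)); rewrite /= !mulrA xu ee.
  - apply/eqP; rewrite eqEsubv; apply/andP; split; apply/subvP => b.
      by case/memv_imgP => b' _ ->; apply/memR; rewrite // amullE mulrA eu.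
    move/(memR _ _ ee') => bE; apply/memv_imgP; exists (x * b).
      by apply/memR; rewrite // mulrA ex.
    by rewrite amullE mulrA ux bE.
  - by move=> b _ b'; rewrite !amullE mulrA.
- have aE : e - x * y * z = a by rewrite {1}eE addrK.
  have eM : e \in M.
    by rewrite -aw aE; apply: (subvP MQ); rewrite memv_mul //; apply/memQ.
  apply/eqP; rewrite eqEsubv sMQ; apply/subvP => q qQ.
  have <- : e * q = q by move/memQ: (qQ) => qE; rewrite -[in LHS]qE !mulrA ee.
  by apply: (subvP MQ); rewrite memv_mul.
Qed.

End Facts.

Section BlockSpace.
Variables (K : fieldType) (R : falgType K) (m : nat).
Variables (e : 'I_m -> R) (n : 'I_m -> nat).

(* (i, j) with 1 <= j <= n_i is encoded with j shifted to 0 <= j < n_i. *)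
Definition block_index : finType := {i : 'I_m & 'I_(n i)}.

Definition block_entry (p q : block_index) : {vspace R} :=
  let: existT i j := p in let: existT s t := q in
  if i == s then
    if (j <= t)%N then corner (e i) fullv (e i) else jacobson (corner (e i) fullv (e i))
  else corner (e i) fullv (e s).

Definition block_matrix := {ffun block_index * block_index -> R}.

Definition block_matrix_entry (p q : block_index) (f : block_matrix) : R := f (p, q).

Fact block_matrix_entry_linear p q : linear (block_matrix_entry p q).
Proof. by move=> a f g; rewrite /block_matrix_entry !ffunE. Qed.

HB.instance Definition _ p q := GRing.isLinear.Build K block_matrix R _
  (block_matrix_entry p q) (block_matrix_entry_linear p q).

Definition block_space : {vspace block_matrix} :=
  (\bigcap_p \bigcap_q linfun (block_matrix_entry p q) @^-1: block_entry p q)%VS.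

Lemma mem_block_space (f : block_matrix) :
  f \in block_space <-> forall p q, f (p, q) \in block_entry p q.
Proof.
split=> [|fP].
  rewrite memvE => /subv_bigcapP fP p q; move/subv_bigcapP: (fP p isT) => /(_ q isT).
  by rewrite -memvE -memv_preim lfunE.
rewrite memvE; apply/subv_bigcapP => p _; apply/subv_bigcapP => q _.
by rewrite -memvE -memv_preim lfunE; apply: fP.
Qed.

Definition block_mul (f g : block_matrix) : block_matrix :=
  [ffun pq => \sum_r f (pq.1, r) * g (r, pq.2)].

Definition block_one : block_matrix :=
  [ffun pq => if pq.1 == pq.2 then e (tag pq.1) else 0].

Definition block_unit (p : block_index) : block_matrix :=
  [ffun pq => if pq == (p, p) then e (tag p) else 0].

End BlockSpace.

Section BlockQuiver.
Variables (m : nat) (n : 'I_m -> nat) (hn : forall i, (0 < n i)%N).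
Variable d : 'I_m -> 'I_m -> nat.

Fact last_lt i : ((n i).-1 < n i)%N.
Proof. by rewrite prednK. Qed.

Fact next_lt i (j : 'I_(n i).-1) : (j.+1 < n i)%N.
Proof. by rewrite -ltn_predRL. Qed.

(* The arrows delta_ij (left) and beta^k_st with k < d s t (right).           *)
Definition block_arrow : finType :=
  ({i : 'I_m & 'I_(n i).-1} + {st : 'I_m * 'I_m & 'I_(d st.1 st.2)})%type.

Definition block_source (a : block_arrow) : block_index n :=
  match a with
  | inl (existT i j) => existT _ i (widen_ord (leq_pred (n i)) j)
  | inr (existT st _) => existT _ st.1 (Ordinal (last_lt st.1))
  end.

Definition block_target (a : block_arrow) : block_index n :=
  match a with
  | inl (existT i j) => existT _ i (Ordinal (next_lt j))
  | inr (existT st _) => existT _ st.2 (Ordinal (hn st.2))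
  end.

Definition block_quiver : quiver := Quiver block_source block_target.

End BlockQuiver.

Section BlockExtension.
Variables (K : fieldType) (R : falgType K) (m : nat) (e : 'I_m -> R).
Hypotheses (he : complete_primitive_idempotents e) (hb : basic e).
Variables (n : 'I_m -> nat) (hn : forall i, (0 < n i)%N).

Let prim i : primitive_idempotent (e i). Proof. by case: he. Qed.
Let idem i : e i * e i = e i. Proof. by case: (prim i). Qed.

Let memE i j x : x \in corner (e i) fullv (e j) <-> e i * x * e j = x.
Proof. exact: mem_corner. Qed.

Lemma block_entry_sub (p q : block_index n) x : x \in block_entry e p q ->
  e (tag p) * x * e (tag q) = x.
Proof.
case: p q => [i j] [s t] /=; case: eqP => [eis|_]; last by move/memE.
by case: ifP => _; rewrite -eis; [move/memE | move/(subvP (jacobson_sub _))/memE].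
Qed.

Lemma block_entry_mul (p r q : block_index n) x y :
  x \in block_entry e p r -> y \in block_entry e r q -> x * y \in block_entry e p q.
Proof.
move=> xP yP; have [xE yE] := (block_entry_sub xP, block_entry_sub yP).
have xyE : e (tag p) * (x * y) * e (tag q) = x * y.
  rewrite -[in RHS]xE -[in RHS]yE -[in LHS]xE -[in LHS]yE.
  by rewrite !mulrA idem -!mulrA idem.
have QQ i : (corner (e i) fullv (e i) * corner (e i) fullv (e i) <= corner (e i) fullv (e i))%VS.
  apply/prodvP => a b /memE <- /memE <-; apply/memE.
  by rewrite !mulrA idem -!mulrA idem.
case: p r q => [i j] [k l] [s t] in xP yP xE yE xyE *; move: xP yP; rewrite /=.
have [eis|nis] := eqVneq i s; last by move=> _ _; apply/memE.
case: s / eis t yE xyE => t yE xyE.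
have [eik|nik] := eqVneq i k.
  case: k / eik l xE yE => l xE yE.
  have JQ := subvP (jacobson_sub (corner (e i) fullv (e i))).
  case: ifP => jl; case: ifP => lt xP yP; case: ifP => jt //.
  - exact/memE.
  - by rewrite (leq_trans jl lt) in jt.
  - exact/memE.
  - exact: jacobson_mull.
  - exact/memE.
  - exact: jacobson_mulr.
  - exact/memE.
  - by apply: jacobson_mulr => //; apply: JQ.
move=> xP yP; case: ifP => _; first exact/memE.
apply: (@corner_product _ _ (e i) (e k)) => // /hb eik.
by rewrite eik eqxx in nik.
Qed.

Lemma block_mul_space (f g : block_matrix R n) :
  f \in block_space e n -> g \in block_space e n -> block_mul f g \in block_space e n.
Proof.
move=> /mem_block_space fP /mem_block_space gP; apply/mem_block_space => p q.
by rewrite ffunE rpred_sum // => r _; apply: block_entry_mul (fP p r) (gP r q).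
Qed.

Lemma block_diag_entry (p : block_index n) : e (tag p) \in block_entry e p p.
Proof. by case: p => i j /=; rewrite eqxx leqnn; apply/memE; rewrite !idem. Qed.

Lemma block_one_space : block_one e n \in block_space e n.
Proof.
apply/mem_block_space => p q; rewrite ffunE /=.
by case: eqP => [<-|_]; [apply: block_diag_entry | apply: mem0v].
Qed.

Lemma block_unit_space (p : block_index n) : block_unit e p \in block_space e n.
Proof.
apply/mem_block_space => q r; rewrite ffunE /=.
by case: eqP => [[-> ->]|_]; [apply: block_diag_entry | apply: mem0v].
Qed.

(* The hypotheses are parameters of the type so that it carries its algebra   *)
(* structure: closure under multiplication needs e_i R e_k R e_i to lie in    *)
(* J(e_i R e_i) for i <> k, that is basicness, and 1 <> 0 needs the n_i > 0.  *)
Definition block_extension (_ : complete_primitive_idempotents e) (_ : basic e)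
  (_ : forall i, (0 < n i)%N) := subvs_of (block_space e n).

Local Notation P := (block_extension he hb hn).

HB.instance Definition _ := Vector.copy P (subvs_of (block_space e n)).

Definition block_extension_mul (x y : P) : P :=
  Subvs (block_mul_space (subvsP x) (subvsP y)).

Definition block_extension_one : P := Subvs block_one_space.

Definition block_idempotent (p : block_index n) : P := Subvs (block_unit_space p).

Fact block_mulA : associative block_extension_mul.
Proof.
move=> x y z; apply/val_inj/ffunP => -[p q] /=; rewrite !ffunE /=.
under eq_bigr do rewrite ffunE /= mulr_sumr.
rewrite exchange_big /=; apply: eq_bigr => r _; rewrite ffunE /= mulr_suml.
by apply: eq_bigr => s _; rewrite mulrA.
Qed.

Fact block_mul1 : left_id block_extension_one block_extension_mul.
Proof.
move=> x; apply/val_inj/ffunP => -[p q] /=; rewrite !ffunE /= (bigD1 p) //=.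
rewrite big1 => [|r rp]; last by rewrite ffunE /= eq_sym (negPf rp) mul0r.
have /mem_block_space/(_ p q)/block_entry_sub xE := subvsP x.
by rewrite ffunE /= eqxx addr0 -[in LHS]xE !mulrA idem.
Qed.

Fact block_mulr1 : right_id block_extension_one block_extension_mul.
Proof.
move=> x; apply/val_inj/ffunP => -[p q] /=; rewrite !ffunE /= (bigD1 q) //=.
rewrite big1 => [|r rp]; last by rewrite ffunE /= (negPf rp) mulr0.
have /mem_block_space/(_ p q)/block_entry_sub xE := subvsP x.
by rewrite ffunE /= eqxx addr0 -[in LHS]xE -mulrA idem.
Qed.

Fact block_mulDl : left_distributive block_extension_mul +%R.
Proof.
move=> x y z; apply/val_inj/ffunP => -[p q] /=; rewrite !ffunE /= -big_split /=.
by apply: eq_bigr => r _; rewrite ffunE mulrDl.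
Qed.

Fact block_mulDr : right_distributive block_extension_mul +%R.
Proof.
move=> x y z; apply/val_inj/ffunP => -[p q] /=; rewrite !ffunE /= -big_split /=.
by apply: eq_bigr => r _; rewrite ffunE mulrDr.
Qed.

Fact block_one_neq0 : block_extension_one != 0.
Proof.
have [i] : exists i : 'I_m, true.
  apply: contrapT => nex; case: he => _ _ /eqP; rewrite big1 => [|i _].
    by rewrite eq_sym oner_eq0.
  by case: nex; exists i.
move=> _; apply/eqP => /(congr1 val)/ffunP.
move=> /(_ (existT _ i (Ordinal (hn i)), existT _ i (Ordinal (hn i)))).
rewrite !ffunE /= eqxx => ei0; have [_ /eqP[]] := prim i; exact: ei0.
Qed.

HB.instance Definition _ := GRing.Zmodule_isNzRing.Build P
  block_mulA block_mul1 block_mulr1 block_mulDl block_mulDr block_one_neq0.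

Fact block_scalerAl (a : K) (x y : P) : a *: (x * y) = a *: x * y.
Proof.
apply/val_inj/ffunP => -[p q] /=; rewrite !ffunE /= scaler_sumr.
by apply: eq_bigr => r _; rewrite ffunE scalerAl.
Qed.

HB.instance Definition _ := GRing.Lmodule_isLalgebra.Build K P block_scalerAl.

Fact block_scalerAr (a : K) (x y : P) : a *: (x * y) = x * (a *: y).
Proof.
apply/val_inj/ffunP => -[p q] /=; rewrite !ffunE /= scaler_sumr.
by apply: eq_bigr => r _; rewrite ffunE scalerAr.
Qed.

HB.instance Definition _ := GRing.Lalgebra_isAlgebra.Build K P block_scalerAr.
HB.instance Definition _ := Algebra_isFalgebra.Build K P.

End BlockExtension.

(* Main.v *)
Require Import Defs.
From HB Require Import structures.
From mathcomp Require Import all_boot all_order all_algebra all_field.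
From mathcomp Require Import boolp.

(** Over an algebraically closed field the quiver of a basic algebra is read
    off the spaces [e_i J e_j] and [e_i J^2 e_j], the number of arrows being
    the difference of their dimensions ([num_arrowsE]).  So the proof computes
    these two spaces for the block extension [P], as spaces of matrix entries.

    The radical is handled through quasi-regularity: [x] lies in the Jacobson
    radical iff [1 - x y] is right invertible for every [y]
    ([jacobson_quasi_regular]).  This shows that [J(eAe)] is the intersection
    of [eAe] and [J(A)] ([jacobson_corner]) and, when [A] is basic, [e_i A e_j <= J(A)] for
    [i != j] ([off_diagonal_jacobson]); hence an element of a basic algebra is
    in the radical as soon as its diagonal Peirce components are
    ([jacobson_diagonal]).

    This applies to [P] too, once its idempotents [f_p] are known to be
    primitive and basic.  They are primitive because [f_p P f_p] is the corner
    [e_i R e_i].  An isomorphism from [f_p P] to [f_q P] with [p != q] would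
    write [e_i] as a product of an entry at [(p, q)] and an entry at [(q, p)],
    and one of these two always lies in [J(R)] ([block_basic]).  The result is
    that [J(P)] consists of the matrices whose entry at [((i,j),(s,t))] lies in
    [e_i R e_i] if [i = s] and [j < t], and in [e_i J(R) e_s] otherwise
    ([mem_block_jacobson]); the entries of [J(P)^2] are sums of products of
    such entries ([entry_img_jacobson2]).

    Comparing the two is then a matter of factoring through a neighbour.  If
    [(i,j)] is not the last vertex of its block, an entry of [J(P)] at
    [((i,j),(s,t))] factors as [e_i] at [((i,j),(i,j+1))] times itself, unless
    [(s,t) = (i,j+1)]; and if [(s,t)] is not the first vertex of its block, it
    factors through [(s,t-1)] in the same way.  So there are no arrows except
    in two cases.  From [(i,j)] to [(i,j+1)] the quotient is
    [e_i R e_i / e_i J e_i], of dimension 1 as [K] is algebraically closed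
    ([dim_corner_residue]).  From [(i,n_i)] to [(s,1)] no full corner
    [e_i R e_i] can occur in a product, and what remains is
    [e_i J e_s / e_i J^2 e_s], which counts the arrows of [R] from [i] to
    [s]. *)

Set Implicit Arguments.
Unset Strict Implicit.
Unset Printing Implicit Defensive.

Import GRing.Theory.

(** * The Jacobson radical and Peirce corners *)

Section QuasiRegular.
Local Open Scope ring_scope.
Variables (K : fieldType) (A : falgType K).
Implicit Types (U V W M : {vspace A}) (e f u x y z : A).

Lemma peirce_mull e f x : e * x * f = x -> e * e = e -> e * x = x.
Proof. by move=> xE ee; rewrite -[in LHS]xE !mulrA ee xE. Qed.

Lemma peirce_mulr e f x : e * x * f = x -> f * f = f -> x * f = x.
Proof. by move=> xE ff; rewrite -[in LHS]xE -mulrA ff xE. Qed.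

(** A strictly larger proper right ideal has larger dimension, so enlarging
    [V] stops. *)
Lemma ex_maximal_right_ideal U V : right_ideal U V -> V <> U ->
  exists2 M, maximal_right_ideal U M & (V <= M)%VS.
Proof.
have [d] := ubnP (\dim U - \dim V); elim: d V => // d IHd V ltd VU nVU.
have [maxV|nmaxV] := EM (maximal_right_ideal U V); first by exists V.
have [W [WU sVW nWV nWU]] :
    exists W, [/\ right_ideal U W, (V <= W)%VS, W <> V & W <> U].
  apply: contrapT => nex; apply: nmaxV; split=> // W WU sVW.
  apply: contrapT => nW; apply: nex; exists W; split=> //.
    by move=> eWV; apply: nW; left.
  by move=> eWU; apply: nW; right.
have ltVW : (\dim V < \dim W)%N.
  rewrite (ltn_leqif (dimv_leqif_sup sVW)); apply/negP => sWV; apply: nWV.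
  by apply/eqP; rewrite eqEsubv sWV.
have leWU : (\dim W <= \dim U)%N by case: WU => /dimvS.
have [|M maxM sWM] := IHd W _ WU nWU; last by exists M; rewrite ?(subv_trans sVW).
apply: leq_trans (ltd : (_ <= d)%N); rewrite ltn_sub2l //.
exact: leq_trans ltVW leWU.
Qed.

(** If [(u - x y) U] were proper it would lie in a maximal right ideal, which
    also contains [x y], hence [u].  Conversely a maximal right ideal [M]
    avoiding [x] satisfies [M + x U = U], so [u - x y] is in [M] for some [y].
    The identity [u] of [U] is a parameter so that corners are covered. *)
Lemma jacobson_quasi_regular U u x : (U * U <= U)%VS -> u \in U ->
    {in U, forall y, u * y = y} -> {in U, forall y, y * u = y} -> x \in U ->
  x \in jacobson U <->
  {in U, forall y, exists2 z, z \in U & (u - x * y) * z = u}.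
Proof.
move=> UU uU uy yu xU.
have UM y z : y \in U -> z \in U -> y * z \in U.
  by move=> yU zU; rewrite (subvP UU) ?memv_mul.
split=> [/mem_jacobson[_ xM] y yU|xy].
  apply: contrapT => nz.
  pose V := (amull (u - x * y) @: U)%VS.
  have VU : right_ideal U V.
    split; first by apply/subvP => _ /memv_imgP[z zU ->]; rewrite amullE UM ?rpredB ?UM.
    apply/prodvP => _ w /memv_imgP[z zU ->] wU; apply/memv_imgP.
    by exists (z * w); rewrite ?UM // !amullE mulrA.
  have nVU : V <> U.
    move=> eVU; apply: nz; move: uU; rewrite -{1}eVU => /memv_imgP[z zU uE].
    by exists z; rewrite // -amullE -uE.
  have [M maxM sVM] := ex_maximal_right_ideal VU nVU.
  have [[sMU MU] nMU _] := maxM; apply: nMU.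
  suff uM : u \in M.
    apply/eqP; rewrite eqEsubv sMU; apply/subvP => z zU.
    by rewrite -(uy z) // (subvP MU) ?memv_mul.
  rewrite -(subrK (x * y) u) rpredD //; last by rewrite (subvP MU) ?memv_mul ?xM.
  apply: (subvP sVM); apply/memv_imgP; exists u => //.
  by rewrite amullE yu ?rpredB ?UM.
apply/mem_jacobson; split=> // M [[sMU MU] nMU maxM].
apply: contrapT => nxM; apply: nMU.
have NU : right_ideal U (M + amull x @: U)%VS.
  split.
    by rewrite subv_add sMU; apply/subvP => _ /memv_imgP[z zU ->]; rewrite amullE UM.
  rewrite prodvDl addvS //; apply/prodvP => _ w /memv_imgP[z zU ->] wU.
  by apply/memv_imgP; exists (z * w); rewrite ?UM // !amullE mulrA.
have [eM|eU] := maxM _ NU (addvSl _ _).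
  case: nxM; rewrite -eM (subvP (addvSr _ _)) //; apply/memv_imgP.
  by exists u; rewrite // amullE yu.
move: (uU); rewrite -{1}eU => /memv_addP[a aM [_ /memv_imgP[y yU ->]]].
rewrite amullE => uE; have [z zU] := xy y yU; rewrite {1}uE addrK => azu.
apply/eqP; rewrite eqEsubv sMU; apply/subvP => w wU.
by rewrite -(uy w) // (subvP MU) ?memv_mul // -azu (subvP MU) ?memv_mul.
Qed.

Lemma mem_jacobsonT x :
  x \in jacobson fullv <-> forall y, exists z, (1 - x * y) * z = 1.
Proof.
have /= := @jacobson_quasi_regular fullv 1 x (subvf _) (memvf _).
move=> ->; rewrite ?memvf //; first last.
- by move=> y _; rewrite mulr1.
- by move=> y _; rewrite mul1r.
split=> xP y; first by have [z _ zE] := xP y (memvf y); exists z.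
by move=> _; have [z zE] := xP y; exists z; rewrite ?memvf.
Qed.

Lemma jacobsonMr x y : x \in jacobson fullv -> x * y \in jacobson (fullv : {vspace A}).
Proof. by move=> xJ; apply: jacobson_mulr; rewrite ?subvf ?memvf. Qed.

Lemma jacobsonMl x y : x \in jacobson fullv -> y * x \in jacobson (fullv : {vspace A}).
Proof. by move=> xJ; apply: jacobson_mull; rewrite ?subvf ?memvf. Qed.

Lemma idempotent_jacobson_eq0 e : e * e = e -> e \in jacobson fullv -> e = 0.
Proof.
move=> ee /mem_jacobsonT/(_ 1)[z /(congr1 ( *%R e))].
by rewrite mulr1 mulrA mulrBr mulr1 ee subrr mul0r.
Qed.

Lemma mem_jacobson_corner e x : e * e = e ->
  x \in jacobson (corner e fullv e) <->
  e * x * e = x /\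
  forall y, e * y * e = y -> exists z, e * z * e = z /\ (e - x * y) * z = e.
Proof.
move=> ee; have memC y := @mem_corner _ _ e e y ee ee.
have CC : (corner e fullv e * corner e fullv e <= corner e fullv e)%VS.
  apply/prodvP => a b /memC <- /memC <-; apply/memC.
  by rewrite !mulrA ee -!mulrA ee.
have eC : e \in corner e fullv e by apply/memC; rewrite !ee.
have el : {in corner e fullv e, forall y, e * y = y}.
  by move=> y /memC <-; rewrite !mulrA ee.
have er : {in corner e fullv e, forall y, y * e = y}.
  by move=> y /memC <-; rewrite -!mulrA ee.
split=> [xJ|[/memC xC xP]].
  have xC := subvP (jacobson_sub _) _ xJ; split; first exact/memC.
  move=> y /memC yC; have [z /memC zE xyz] := (jacobson_quasi_regular CC eC el er xC).1 xJ y yC.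
  by exists z.
apply/(jacobson_quasi_regular CC eC el er xC) => y /memC/xP[z [/memC zC zE]].
by exists z.
Qed.

(** If [e x = x] then, along the decomposition of the unit into [e] and
    [1 - e], [1 - x] is block triangular with diagonal blocks [e - x e] and
    [1 - e], so only the first needs inverting. *)
Lemma right_inverse_corner e x z : e * e = e -> e * x = x -> e * z = z ->
  (e - x * e) * z = e -> exists w, (1 - x) * w = 1.
Proof.
move=> ee ex ez zE; have xz : (1 - x) * z = e.
  by rewrite -[RHS]zE !mulrBl mul1r ez -mulrA ez.
have [t et] : exists t, 1 = e + t by exists (1 - e); rewrite addrC subrK.
exists (z + t + z * (x * t)); rewrite !mulrDr [_ * (z * _)]mulrA xz.
by rewrite [e * _]mulrA ex mulrBl mul1r -addrA subrK.
Qed.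

(** For [x] in [eAe], [1 - x y] is block triangular with diagonal block
    [e - x (e y e)], which depends on [y] only through [eAe]. *)
Lemma jacobson_corner e x : e * e = e ->
  x \in jacobson (corner e fullv e) <-> x \in jacobson fullv /\ e * x * e = x.
Proof.
move=> ee; rewrite mem_jacobson_corner //; split=> [[xE xP]|[xJ xE]]; split=> //.
  have ex := peirce_mull xE ee.
  have xe := peirce_mulr xE ee.
  apply/mem_jacobsonT => y.
  have [|z [zE xz]] := xP (e * y * e); first by rewrite !mulrA ee -!mulrA ee.
  apply: (right_inverse_corner (e := e) (z := z)); rewrite ?mulrA ?ex //.
    exact: peirce_mull zE _.
  by rewrite -[RHS]xz !mulrA xe.
move=> y yE; have /mem_jacobsonT/(_ y)[z zE] := xJ.
have ex := peirce_mull xE ee.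
have ye := peirce_mulr yE ee.
exists (e * z * e); split; first by rewrite !mulrA ee -!mulrA ee.
have -> : e - x * y = e * (1 - x * y) by rewrite mulrBr mulr1 mulrA ex.
rewrite !mulrA; have -> : e * (1 - x * y) * e = e * (1 - x * y).
  by rewrite mulrBr mulrBl mulr1 ee -!mulrA ye.
by rewrite -[e * _ * z]mulrA zE mulr1 ee.
Qed.

Section Basic.
Variables (I : finType) (e : I -> A).
Hypotheses (he : complete_primitive_idempotents e) (hb : basic e).

Let prim i : primitive_idempotent (e i). Proof. by case: he. Qed.
Let idem i : e i * e i = e i. Proof. by case: (prim i). Qed.
Let sum1 : \sum_i e i = 1. Proof. by case: he. Qed.

Lemma primitive_notin_jacobson i : e i \notin jacobson fullv.
Proof.
by apply/negP => /(idempotent_jacobson_eq0 (idem i)) /eqP; case: (prim i) => _ /negPf->.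
Qed.

(** For [x] in [e_i A e_j], the diagonal block of [1 - x y] is
    [e_i - x (e_j y e_i)], and the product is in the radical of [e_i A e_i]
    because [e_i A] and [e_j A] are not isomorphic. *)
Lemma off_diagonal_jacobson i j x : i != j -> e i * x * e j = x -> x \in jacobson fullv.
Proof.
move=> nij xE; apply/mem_jacobsonT => y.
have ex := peirce_mull xE (idem _).
have xe := peirce_mulr xE (idem _).
have : x * (e j * y * e i) \in jacobson (corner (e i) fullv (e i)).
  apply: (corner_product (prim i) (prim j)).
  - by move=> /hb eij; rewrite eij eqxx in nij.
  - exact/mem_corner.
  - by apply/mem_corner; rewrite ?idem // !mulrA idem -!mulrA idem.
move/(mem_jacobson_corner _ (idem i)) => [_ /(_ (e i))[|z [zE]]]; first by rewrite !idem.
rewrite !mulrA xe -[_ * e i * e i]mulrA idem => xz.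
apply: (right_inverse_corner (idem i) _ _ xz); first by rewrite mulrA ex.
exact: peirce_mull zE _.
Qed.

Lemma peirce_decomposition x : x = \sum_i \sum_j e i * x * e j.
Proof.
rewrite -[LHS]mul1r -[LHS]mulr1 -sum1 mulr_suml mulr_suml; apply: eq_bigr => i _.
by rewrite mulr_sumr.
Qed.

(** In the Peirce decomposition of [x] the off-diagonal components are in the
    radical whatever [x] is. *)
Lemma jacobson_diagonal x :
  (forall i, e i * x * e i \in jacobson (corner (e i) fullv (e i))) ->
  x \in jacobson fullv.
Proof.
move=> xJ; rewrite (peirce_decomposition x); apply: rpred_sum => i _; apply: rpred_sum => j _.
have [<-|nij] := eqVneq i j; first by have /(jacobson_corner _ (idem i))[] := xJ i.
by apply: (off_diagonal_jacobson nij); rewrite !mulrA idem -!mulrA idem.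
Qed.

End Basic.

Lemma mem_corner_ideal U e f x : e * e = e -> f * f = f ->
    (forall y z, y \in U -> y * z \in U) -> (forall y z, y \in U -> z * y \in U) ->
  x \in corner e U f <-> x \in U /\ e * x * f = x.
Proof.
move=> ee ff UA AU; split=> [xC|[xU <-]]; last by rewrite !memv_mul ?memv_line.
split; last by apply/(mem_corner _ ee ff); apply: subvP xC; rewrite !prodvS ?subvf.
apply: subvP xC; apply/prodvP => a b aP /vlineP[k ->].
rewrite UA //; apply: subvP aP; apply/prodvP => c d /vlineP[l ->] dU; exact: AU.
Qed.

Lemma mem_corner_jacobson e f x : e * e = e -> f * f = f ->
  x \in corner e (jacobson fullv) f <-> x \in jacobson fullv /\ e * x * f = x.
Proof.
by move=> ee ff; apply: mem_corner_ideal => // y z; [apply: jacobsonMr | apply: jacobsonMl].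
Qed.

Lemma jacobson2Mr x y : x \in (jacobson fullv * jacobson fullv)%VS ->
  x * y \in (jacobson fullv * jacobson fullv : {vspace A})%VS.
Proof.
move=> xJ; set J := jacobson _ in xJ *.
apply: (subvP (_ : J * J * fullv <= J * J)%VS); rewrite ?memv_mul ?memvf //.
by rewrite -prodvA prodvS //; apply/prodvP => a b aJ _; apply: jacobsonMr.
Qed.

Lemma jacobson2Ml x y : x \in (jacobson fullv * jacobson fullv)%VS ->
  y * x \in (jacobson fullv * jacobson fullv : {vspace A})%VS.
Proof.
move=> xJ; set J := jacobson _ in xJ *.
apply: (subvP (_ : fullv * (J * J) <= J * J)%VS); rewrite ?memv_mul ?memvf //.
by rewrite prodvA prodvS //; apply/prodvP => a b _ bJ; apply: jacobsonMl.
Qed.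

Lemma mem_corner_jacobson2 e f x : e * e = e -> f * f = f ->
  let J := jacobson fullv in
  x \in corner e (J * J)%VS f <-> x \in (J * J)%VS /\ e * x * f = x.
Proof.
by move=> ee ff J; apply: mem_corner_ideal => // y z; [apply: jacobson2Mr | apply: jacobson2Ml].
Qed.

(** The intersection of [e_i J e_j] with [J^2] is [e_i J^2 e_j], so the
    quotient of dimensions in the definition can be taken inside the corner. *)
Lemma num_arrowsE (I : finType) (e : I -> A) i j : (forall i, e i * e i = e i) ->
  let J := jacobson fullv in
  num_arrows e i j = (\dim (corner (e i) J (e j)) - \dim (corner (e i) (J * J)%VS (e j)))%N.
Proof.
move=> idem J; rewrite /num_arrows -/J.
have -> : corner (e i) (J * J)%VS (e j) = (corner (e i) J (e j) :&: J * J)%VS.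
  apply/vspaceP => x; rewrite memv_cap; apply/idP/andP.
    move/mem_corner_jacobson2=> [||xJ xE] //; split=> //; apply/mem_corner_jacobson => //.
    split=> //; apply: subvP xJ; apply/prodvP => a b aJ _; exact: jacobsonMr.
  move=> [/mem_corner_jacobson[] // _ xE xJ]; exact/mem_corner_jacobson2.
set C := corner _ J _.
by rewrite -[in RHS](addnK (\dim (J * J)) (\dim C)) -dimv_sum_cap subnAC addnK.
Qed.

End QuasiRegular.

(** * Residue fields over an algebraically closed field *)

Section Residue.
Local Open Scope ring_scope.

(** The powers of [x] up to the dimension of [A] are linearly dependent. *)
Lemma ex_annihilating_poly (K : fieldType) (A : falgType K) (x : A) :
  exists2 p : {poly K}, p != 0 & horner_alg x p = 0.
Proof.
pose d := \dim {:A}; pose X := [tuple x ^+ i | i < d.+1].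
have nfree : ~~ free X.
  apply/negP => /eqP eqd; have := dimvS (subvf <<X>>%VS).
  by rewrite eqd size_tuple ltnn.
have [c c0 [i0 ci0]] : exists2 c : 'I_d.+1 -> K,
    \sum_i c i *: x ^+ i = 0 & exists i, c i != 0.
  apply: contrapT => nex; case/negP: nfree; apply/freeP => c c0 i.
  apply: contrapT => /eqP ci; apply: nex; exists c; last by exists i.
  by rewrite -[RHS]c0; apply: eq_bigr => j _; rewrite -tnth_nth tnth_mktuple.
exists (\poly_(i < d.+1) c (inord i)).
  apply: contraNneq ci0 => /polyP/(_ i0); rewrite coef0 coef_poly ltn_ord.
  by rewrite inord_val => /eqP.
rewrite poly_def linear_sum -[RHS]c0; apply: eq_bigr => i _.
by rewrite inord_val linearZ rmorphXn /= horner_algX mulr_algl.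
Qed.

(** By Fitting's lemma one of [x y] and [e - x y] has a right inverse in
    [eAe], and the first would provide one for [x]. *)
Lemma nonunit_jacobson (K : fieldType) (A : falgType K) (e x : A) :
    primitive_idempotent e -> e * x * e = x ->
    (forall w, e * w * e = w -> x * w <> e) ->
  x \in jacobson (corner e fullv e).
Proof.
move=> prim xE nx; have [ee _ _] := prim; apply/mem_jacobson_corner => //.
split=> // y yE.
have ex := peirce_mull xE ee.
have ye := peirce_mulr yE ee.
have ey := peirce_mull yE ee.
have [|z [zE [xyz|xyz]]] := @fitting _ _ e (x * y) prim; last by exists z.
  by rewrite mulrA ex -mulrA ye.
case: (nx (y * z)); last by rewrite mulrA.
by rewrite mulrA ey -mulrA -[in LHS]zE -[_ * e * e]mulrA ee zE.
Qed.

Variables (K : closedFieldType) (A : falgType K) (e : A).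
Hypothesis prim : primitive_idempotent e.

(** A polynomial annihilating [x] splits into linear factors.  If
    [x - a e] had a right inverse in [eAe] for every root [a], so would the
    product of these elements, which is zero; so one of them is not right
    invertible, hence is in the radical. *)
Lemma residue_field x : e * x * e = x ->
  exists a : K, x - a *: e \in jacobson (corner e fullv e).
Proof.
have [ee e0 _] := prim; move=> xE.
apply: contrapT => nex.
have [p p0 px] := ex_annihilating_poly x.
have [r pE] := closed_field_poly_normal p.
suff [w wE rw] : exists2 w, e * w * e = w &
    horner_alg x (\prod_(z <- r) ('X - z%:P)) * w = e.
  case/eqP: e0; rewrite -rw; suff -> : horner_alg x (\prod_(z <- r) ('X - z%:P)) = 0.
    by rewrite mul0r.
  move: px; rewrite pE linearZ /= mulr_algl => /eqP.
  by rewrite scaler_eq0 lead_coef_eq0 (negPf p0) => /eqP.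
elim: r {pE} => [|a r [w wE IHr]].
  by exists e; rewrite ?ee // big_nil rmorph1 mul1r.
have ew := peirce_mull wE ee.
have [v [vE xv]] : exists v, e * v * e = v /\ (x - a *: e) * v = e.
  apply: contrapT => nv; apply: nex; exists a.
  apply: nonunit_jacobson => //.
    by rewrite mulrBr mulrBl xE -scalerAr -scalerAl !ee.
  by move=> v vE xv; apply: nv; exists v.
have we := peirce_mulr wE ee.
have ev := peirce_mull vE ee.
exists (v * w); first by rewrite mulrA ev -mulrA we.
rewrite big_cons mulrC rmorphM /= -mulrA [_ * (v * w)]mulrA.
have -> : horner_alg x ('X - a%:P) * v = e.
  by rewrite rmorphB /= horner_algX horner_algC -[RHS]xv !mulrBl mulr_algl -scalerAl ev.
by rewrite ew.
Qed.

(** [eAe] is the direct sum of the line of [e] and of [eJe]. *)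
Lemma dim_corner_residue :
  \dim (corner e fullv e) = (\dim (corner e (jacobson fullv) e)).+1.
Proof.
have [ee e0 _] := prim.
have -> : corner e fullv e = (<[e]> + corner e (jacobson fullv) e)%VS.
  apply/vspaceP => x; apply/idP/idP.
    move/(mem_corner _ ee ee)/residue_field => [a /(jacobson_corner _ ee) xJ].
    rewrite -(subrK (a *: e) x) addrC memv_add ?memvZ ?memv_line //.
    exact/mem_corner_jacobson.
  case/memv_addP => _ /vlineP[a ->] [y /mem_corner_jacobson[] // yJ yE ->].
  apply/mem_corner => //.
  by rewrite mulrDr mulrDl yE -scalerAr -scalerAl !ee.
rewrite dimv_disjoint_sum ?dim_vline ?e0 //.
apply/eqP; rewrite -subv0; apply/subvP => x; rewrite memv_cap memv0.
case/andP => /vlineP[a ->] /mem_corner_jacobson[] //.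
have [->|a0] := eqVneq a 0; first by rewrite scale0r eqxx.
move=> /(memvZ a^-1); rewrite scalerA mulVf // scale1r.
by move=> /(idempotent_jacobson_eq0 ee) /eqP; rewrite (negPf e0).
Qed.

End Residue.

(** * Matrix entries of the block extension and of its radical *)

Section Entries.
Local Open Scope ring_scope.

Variables (K : fieldType) (R : falgType K) (m : nat) (e : 'I_m -> R).
Hypotheses (he : complete_primitive_idempotents e) (hb : basic e).
Variables (n : 'I_m -> nat) (hn : forall i, (0 < n i)%N).

Let prim i : primitive_idempotent (e i). Proof. by case: he. Qed.
Let idem i : e i * e i = e i. Proof. by case: (prim i). Qed.

Local Notation P := (block_extension he hb hn).
Local Notation f := (block_idempotent he hb hn).
Local Notation J := (jacobson fullv).
Implicit Types (p q r : block_index n) (x y : P).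

Definition entry p q (x : P) : R := vsval x (p, q).

Lemma entry_linear p q : linear (entry p q).
Proof. by move=> a x y; rewrite /entry /= !ffunE. Qed.

HB.instance Definition _ p q :=
  GRing.isLinear.Build K P R _ (entry p q) (entry_linear p q).

Lemma entryP x y : (forall p q, entry p q x = entry p q y) -> x = y.
Proof. by move=> xy; apply/val_inj/ffunP => -[p q]; apply: xy. Qed.

Lemma entryM p q x y : entry p q (x * y) = \sum_r entry p r x * entry r q y.
Proof. by rewrite /entry /= ffunE. Qed.

Lemma entry1 p q : entry p q 1 = if p == q then e (tag p) else 0.
Proof. by rewrite /entry /= ffunE. Qed.

Lemma entry_idempotent p q r :
  entry p q (f r) = if (p == r) && (q == r) then e (tag r) else 0.
Proof. by rewrite /entry /= ffunE xpair_eqE. Qed.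

Lemma entry_space p q x : entry p q x \in block_entry e p q.
Proof. by have /mem_block_space := subvsP x; apply. Qed.

Lemma entry_peirce p q x : e (tag p) * entry p q x * e (tag q) = entry p q x.
Proof. exact/block_entry_sub/entry_space. Qed.

Lemma entry_peircel p q x : e (tag p) * entry p q x = entry p q x.
Proof. exact: peirce_mull (entry_peirce p q x) (idem _). Qed.

Lemma entry_peircer p q x : entry p q x * e (tag q) = entry p q x.
Proof. exact: peirce_mulr (entry_peirce p q x) (idem _). Qed.

Lemma entry_idempotentM p q r x :
  entry p q (f r * x) = if p == r then entry r q x else 0.
Proof.
rewrite entryM (bigD1 r) //= big1 => [|s sr]; last first.
  by rewrite entry_idempotent (negPf sr) andbF mul0r.
rewrite entry_idempotent eqxx andbT addr0; case: eqP => _; last by rewrite mul0r.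
exact: entry_peircel.
Qed.

Lemma entry_Midempotent p q r x :
  entry p q (x * f r) = if q == r then entry p r x else 0.
Proof.
rewrite entryM (bigD1 r) //= big1 => [|s sr]; last first.
  by rewrite entry_idempotent (negPf sr) mulr0.
rewrite entry_idempotent eqxx addr0 /=; case: eqP => _; last by rewrite mulr0.
exact: entry_peircer.
Qed.

Lemma entry_corner p q p' q' x : f p * x * f q = x ->
  entry p' q' x = if (p' == p) && (q' == q) then entry p q x else 0.
Proof.
move=> <-; rewrite !entry_Midempotent !entry_idempotentM !eqxx.
by case: (p' == p); case: (q' == q).
Qed.

Lemma corner_entryP p q x y : f p * x * f q = x -> f p * y * f q = y ->
  entry p q x = entry p q y -> x = y.
Proof.
by move=> xE yE xy; apply: entryP => p' q'; rewrite (entry_corner _ _ xE) xy -entry_corner.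
Qed.

Lemma entry_cornerM p q r x y : f p * x * f q = x ->
  entry p r (x * y) = entry p q x * entry q r y.
Proof.
move=> xE; rewrite entryM (bigD1 q) //= big1 ?addr0 // => s sq.
by rewrite (entry_corner _ _ xE) (negPf sq) andbF mul0r.
Qed.

(** The scaled matrix units, by which elements of [R] are carried back to
    [P]. *)
Lemma ex_block_elem p q a : a \in block_entry e p q ->
  exists x : P, f p * x * f q = x /\ entry p q x = a.
Proof.
move=> aP; pose g : block_matrix R n := [ffun pq => if pq == (p, q) then a else 0].
have gP : g \in block_space e n.
  apply/mem_block_space => p' q'; rewrite ffunE xpair_eqE.
  by case: andP => [[/eqP-> /eqP->]|_]; rewrite ?mem0v.
have gE p' q' : entry p' q' (Subvs gP : P) = if (p' == p) && (q' == q) then a else 0.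
  by rewrite /entry /= ffunE xpair_eqE.
exists (Subvs gP); rewrite gE !eqxx; split=> //; apply: entryP => p' q'.
rewrite entry_Midempotent entry_idempotentM !gE eqxx.
by case: (p' == p); case: (q' == q); rewrite ?andbF ?andbT ?eqxx.
Qed.

Lemma block_idempotentM p q : f p * f q = if p == q then f p else 0.
Proof.
apply: entryP => p' q'; rewrite entry_idempotentM entry_idempotent.
have [<-|npq] := eqVneq p q; last by rewrite linear0; case: eqP.
by rewrite entry_idempotent; case: (p' == p).
Qed.

Let fidem p : f p * f p = f p. Proof. by rewrite block_idempotentM eqxx. Qed.

Lemma sum_block_idempotent : \sum_p f p = 1.
Proof.
apply: entryP => p q; rewrite linear_sum entry1 /=.
rewrite (bigD1 p) //= big1 => [|r rp]; last first.
  by rewrite entry_idempotent eq_sym (negPf rp).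
by rewrite entry_idempotent eqxx addr0 eq_sym.
Qed.

Lemma entry_idempotent_diag p : entry p p (f p) = e (tag p).
Proof. by rewrite entry_idempotent eqxx. Qed.

Lemma block_idempotent_primitive p : primitive_idempotent (f p).
Proof.
split=> [//||g h gg hh gh hg fE].
  apply/eqP => /(congr1 (entry p p)); rewrite entry_idempotent_diag linear0.
  by case: (prim (tag p)) => _ /eqP.
have gE : f p * g * f p = g.
  by rewrite fE mulrDl hg addr0 gg mulrDr gg gh addr0.
have hE : f p * h * f p = h.
  by rewrite fE mulrDl gh add0r hh mulrDr hh hg add0r.
have e0 x : f p * x * f p = x -> entry p p x = 0 -> x = 0.
  by move=> xE x0; apply: (corner_entryP xE); rewrite ?x0 ?linear0 ?mulr0 ?mul0r.
have [_ _ ] := prim (tag p).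
case/(_ (entry p p g) (entry p p h)) => [|||||g0|h0].
- by rewrite -entry_cornerM ?gg.
- by rewrite -entry_cornerM ?hh.
- by rewrite -entry_cornerM ?gh ?linear0.
- by rewrite -entry_cornerM ?hg ?linear0.
- by rewrite -linearD -fE /= entry_idempotent_diag.
- by left; apply: e0.
- by right; apply: e0.
Qed.

Lemma block_complete : complete_primitive_idempotents f.
Proof.
split; [exact: block_idempotent_primitive | | exact: sum_block_idempotent].
by move=> p q /negPf npq; rewrite block_idempotentM npq.
Qed.

Lemma block_index_eq p q : tag p = tag q -> tagged p = tagged q :> nat -> p = q.
Proof. by case: p q => [i j] [s t] /= eis; case: s / eis t => t /val_inj->. Qed.

(** For [i != s] the corner [e_i R e_s] is contained in [J(R)], so the three
    cases defining the entries reduce to a full corner on and above the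
    diagonal of a diagonal block, and a radical one elsewhere. *)
Lemma mem_block_entry p q a : a \in block_entry e p q <->
  e (tag p) * a * e (tag q) = a /\
  ((tag p == tag q) && (tagged p <= tagged q)%N || (a \in J)).
Proof.
have mem i j := @mem_corner _ _ (e i) (e j) a (idem i) (idem j).
case: p q => [i j] [s t] /=; have [eis|nis] /= := eqVneq i s; last first.
  split=> [/mem aE|[/mem //]]; split=> //.
  exact: off_diagonal_jacobson nis aE.
case: s / eis t => t; case: ifP => _ /=; first by split=> [/mem|[/mem]].
split=> [/(jacobson_corner _ (idem i))[] //|[aE aJ]]; exact/jacobson_corner.
Qed.

(** An isomorphism gives [a] and [b] in opposite corners with [a b = f_p].
    If [p != q], one of the positions [(p, q)] and [(q, p)] only allows entries
    in [J(R)], which would put [e_i] into [J(R)]. *)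
Lemma block_basic : basic f.
Proof.
move=> p q [phi [phi_inj phi_im phiM]].
have memf r x : x \in (<[f r]> * fullv)%VS <-> f r * x = x.
  split=> [|<-]; last by rewrite memv_mul ?memv_line ?memvf.
  suff: (<[f r]> * fullv <= lker (amull (f r) - \1%VF))%VS.
    by move/subvP => sub /sub; rewrite memv_ker !lfun_simp /= subr_eq0 => /eqP.
  apply/prodvP => _ y /vlineP[k ->] _.
  by rewrite memv_ker !lfun_simp /= -scalerAl -scalerAr mulrA fidem subrr.
have fpP : f p \in (<[f p]> * fullv)%VS by apply/memf.
pose b := phi (f p).
have bE : f q * b = b by apply/memf; rewrite -phi_im memv_img.
have [a aP phia] : exists2 a, a \in (<[f p]> * fullv)%VS & phi a = f q.
  have : f q \in (phi @: (<[f p]> * fullv))%VS by rewrite phi_im; apply/memf.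
  by case/memv_imgP => a aP ->; exists a.
have aE : f p * a = a by apply/memf.
have aE' : a * f q = a.
  by apply: phi_inj => //; [apply/memf; rewrite mulrA aE | rewrite phiM // phia fidem].
have ab : a * b = f p.
  by apply: phi_inj => //; [apply/memf; rewrite mulrA aE | rewrite phiM // phia bE].
have ab_e : entry p q a * entry q p b = e (tag p).
  by rewrite -entry_cornerM ?ab ?entry_idempotent_diag // aE.
have /mem_block_entry[_ aJ] := entry_space p q a.
have /mem_block_entry[_ bJ] := entry_space q p b.
have nJ : e (tag p) \notin J by apply: primitive_notin_jacobson.
case/orP: aJ => [/andP[/eqP tpq lepq]|aJ]; last first.
  by case/negP: nJ; rewrite -ab_e jacobsonMr.
case/orP: bJ => [/andP[_ leqp]|bJ]; last first.
  by case/negP: nJ; rewrite -ab_e jacobsonMl.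
by apply: block_index_eq => //; apply/eqP; rewrite eqn_leq lepq.
Qed.

(** The entries of [J(P)] at [(p, q)]; compared with [block_entry], the
    diagonal has moved to the radical side. *)
Definition rad_entry p q : {vspace R} :=
  if (tag p == tag q) && (tagged p < tagged q)%N
  then corner (e (tag p)) fullv (e (tag q)) else corner (e (tag p)) J (e (tag q)).

Lemma mem_rad_entry p q a : a \in rad_entry p q <->
  e (tag p) * a * e (tag q) = a /\
  ((tag p == tag q) && (tagged p < tagged q)%N || (a \in J)).
Proof.
rewrite /rad_entry; case: ifP => _ /=; first by split=> [/mem_corner|[/mem_corner]]-> //.
by split=> [/mem_corner_jacobson|[aE aJ]]; [case | apply/mem_corner_jacobson].
Qed.

Lemma rad_entry_sub p q : (rad_entry p q <= block_entry e p q)%VS.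
Proof.
apply/subvP => a /mem_rad_entry[aE aJ]; apply/mem_block_entry; split=> //.
by case/orP: aJ => [/andP[-> /ltnW->]|->] //; rewrite orbT.
Qed.

(** Taking the entry at [(p, p)] identifies [f_p P f_p] with [e_i R e_i], and
    quasi-regularity is transported by this identification. *)
Lemma jacobson_entry_diag p x : f p * x * f p = x ->
  x \in jacobson (corner (f p) fullv (f p)) <-> entry p p x \in J.
Proof.
move=> xE; set i := tag p; have xpE := entry_peirce p p x.
suff: x \in jacobson (corner (f p) fullv (f p)) <->
    entry p p x \in jacobson (corner (e i) fullv (e i)).
  move=> ->; split=> [/(jacobson_corner _ (idem i))[] // |xJ].
  exact/jacobson_corner.
have cornerM y z : f p * y * f p = y -> f p * z * f p = z -> f p * (y * z) * f p = y * z.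
  by move=> <- <-; rewrite !mulrA fidem -!mulrA fidem.
have diag (a : R) : e i * a * e i = a ->
    exists y : P, f p * y * f p = y /\ entry p p y = a.
  by move=> aE; apply: ex_block_elem; apply/mem_block_entry; rewrite eqxx leqnn.
split.
  move/(mem_jacobson_corner _ (fidem p)) => [_ xP].
  apply/mem_jacobson_corner => //; split=> // a /diag[y [yE <-]].
  have [z [zE xyz]] := xP y yE; exists (entry p p z); split; first exact: entry_peirce.
  rewrite -entry_cornerM // -entry_idempotent_diag -linearB /=.
  by rewrite -entry_cornerM ?xyz // mulrBr mulrBl !fidem cornerM.
move/(mem_jacobson_corner _ (idem i)) => [_ xP].
apply/mem_jacobson_corner => //; split=> // y yE.
have [_ [/diag[z [zE <-]] xyz]] := xP (entry p p y) (entry_peirce p p y).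
exists z; split=> //.
have xyE : f p * (f p - x * y) * f p = f p - x * y by rewrite mulrBr mulrBl !fidem cornerM.
apply: (@corner_entryP p p); rewrite ?cornerM // ?fidem //.
by rewrite (@entry_cornerM p p) // linearB /= (@entry_cornerM p p) // entry_idempotent_diag.
Qed.

(** [P] is basic, so membership in its radical is decided on the diagonal;
    off the diagonal the constraint on radical entries is the one on entries
    of [P]. *)
Lemma mem_block_jacobson x :
  x \in jacobson fullv <-> forall p q, entry p q x \in rad_entry p q.
Proof.
have J_diag p : x \in J -> entry p p x \in J.
  move=> xJ; have fxE : f p * (f p * x * f p) * f p = f p * x * f p.
    by rewrite !mulrA fidem -!mulrA fidem.
  have : f p * x * f p \in jacobson (corner (f p) fullv (f p)).
    by apply/jacobson_corner => //; rewrite jacobsonMr ?jacobsonMl.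
  move/(jacobson_entry_diag fxE).
  by rewrite entry_Midempotent eqxx entry_idempotentM eqxx.
split=> [xJ p q|xJ].
  apply/mem_rad_entry; split; first exact: entry_peirce.
  have /mem_block_entry[_] := entry_space p q x.
  case/orP=> [/andP[tpq lepq]|->]; last by rewrite orbT.
  rewrite tpq ltn_neqAle lepq andbT /=; have [epq|//] := eqVneq.
  by have <- := block_index_eq (eqP tpq) epq; rewrite /= J_diag.
apply: (jacobson_diagonal block_complete block_basic) => p.
apply/jacobson_entry_diag; first by rewrite !mulrA fidem -!mulrA fidem.
rewrite entry_Midempotent eqxx entry_idempotentM eqxx.
by have /mem_rad_entry[_] := xJ p p; rewrite ltnn andbF.
Qed.

(** An element of [f_p P f_q] is determined by its entry at [(p, q)]. *)
Lemma dim_corner_entry_img p q (U : {vspace P}) :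
    (forall x y, x \in U -> x * y \in U) -> (forall x y, x \in U -> y * x \in U) ->
  \dim (corner (f p) U (f q)) = \dim (linfun (entry p q) @: U)%VS.
Proof.
move=> Ur Ul.
have -> : (linfun (entry p q) @: U = linfun (entry p q) @: corner (f p) U (f q))%VS.
  apply/vspaceP => a; apply/memv_imgP/memv_imgP => -[x xU ->]; last first.
    by exists x => //; have [] := (mem_corner_ideal _ (fidem p) (fidem q) Ur Ul).1 xU.
  exists (f p * x * f q).
    by rewrite !memv_mul ?memv_line.
  by rewrite !lfunE /= entry_Midempotent eqxx entry_idempotentM eqxx.
apply/esym/limg_dim_eq/eqP; rewrite -subv0; apply/subvP => x.
rewrite memv_cap memv0 memv_ker lfunE /= => /andP[xC /eqP x0].
have [_ xE] := (mem_corner_ideal _ (fidem p) (fidem q) Ur Ul).1 xC.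
by apply/eqP/(corner_entryP xE); rewrite ?x0 ?linear0 ?mulr0 ?mul0r.
Qed.

Lemma entry_img_jacobson p q :
  (linfun (entry p q) @: jacobson fullv)%VS = rad_entry p q.
Proof.
apply/vspaceP => a; apply/memv_imgP/idP => [[x /mem_block_jacobson xJ ->]|aP].
  by rewrite lfunE; apply: xJ.
have [x [xE xa]] := ex_block_elem (subvP (rad_entry_sub p q) _ aP).
exists x; last by rewrite lfunE.
apply/mem_block_jacobson => p' q'; rewrite (entry_corner _ _ xE) xa.
by case: andP => [[/eqP-> /eqP->]|_]; rewrite ?mem0v.
Qed.

Definition rad2_entry p q : {vspace R} := (\sum_r rad_entry p r * rad_entry r q)%VS.

Lemma entry_img_jacobson2 p q :
  (linfun (entry p q) @: (jacobson fullv * jacobson fullv))%VS = rad2_entry p q.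
Proof.
apply/eqP; rewrite eqEsubv; apply/andP; split.
  apply/subvP => _ /memv_imgP[z zJ ->]; rewrite memv_preim.
  apply: subvP zJ; apply/prodvP => x y /mem_block_jacobson xJ /mem_block_jacobson yJ.
  rewrite -memv_preim lfunE /= entryM; apply: memv_sumr => r _.
  exact: memv_mul (xJ p r) (yJ r q).
apply/subv_sumP => r _; apply/prodvP => a b.
rewrite -!entry_img_jacobson => /memv_imgP[x xJ ->] /memv_imgP[y yJ ->].
(* Inserting [f_r] isolates the summand of index [r] in the matrix product. *)
rewrite !lfunE /=; apply/memv_imgP; exists (x * f r * y).
  by rewrite memv_mul // jacobsonMr.
rewrite lfunE /= entryM (bigD1 r) //= big1 ?addr0 => [|s sr].
  by rewrite entry_Midempotent eqxx.
by rewrite entry_Midempotent (negPf sr) mul0r.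
Qed.

Lemma block_num_arrows p q :
  num_arrows f p q = (\dim (rad_entry p q) - \dim (rad2_entry p q))%N.
Proof.
rewrite num_arrowsE // dim_corner_entry_img ?entry_img_jacobson; first last.
- by move=> x y; apply: jacobsonMl.
- by move=> x y; apply: jacobsonMr.
rewrite dim_corner_entry_img ?entry_img_jacobson2 // => x y.
  exact: jacobson2Mr.
exact: jacobson2Ml.
Qed.

End Entries.

(** * Entries of the squared radical *)

Section Arrows.
Local Open Scope ring_scope.

Variables (K : fieldType) (R : falgType K) (m : nat) (e : 'I_m -> R).
Hypothesis he : complete_primitive_idempotents e.
Variables (n : 'I_m -> nat) (hn : forall i, (0 < n i)%N).

Let prim i : primitive_idempotent (e i). Proof. by case: he. Qed.
Let idem i : e i * e i = e i. Proof. by case: (prim i). Qed.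

Local Notation J := (jacobson fullv).
Implicit Types (p q r : block_index n).

Definition consecutive p q := (tag p == tag q) && (tagged q == (tagged p).+1 :> nat).
Definition last_first p q :=
  (tagged p == (n (tag p)).-1 :> nat) && (tagged q == 0%N :> nat).

(** A product of two entries outside [J(R)] requires an index strictly between
    [p] and [q] in a common block. *)
Lemma mem_rad2_entry p q a : a \in rad2_entry e p q ->
  e (tag p) * a * e (tag q) = a /\
  ((tag p == tag q) && ((tagged p).+1 < tagged q)%N || (a \in J)).
Proof.
pose W := if (tag p == tag q) && ((tagged p).+1 < tagged q)%N
  then corner (e (tag p)) fullv (e (tag q)) else corner (e (tag p)) J (e (tag q)).
have WP b : e (tag p) * b * e (tag q) = b ->
    ((tag p == tag q) && ((tagged p).+1 < tagged q)%N || (b \in J)) -> b \in W.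
  rewrite /W; case: ifP => _ bE /= bJ; first exact/mem_corner.
  exact/mem_corner_jacobson.
suff /subvP sW : (rad2_entry e p q <= W)%VS.
  move/sW; rewrite /W; case: ifP => _ /=; first by move/mem_corner => ->.
  by move/mem_corner_jacobson => [].
apply/subv_sumP => r _; apply/prodvP => b c /(mem_rad_entry he)[bE bJ] /(mem_rad_entry he)[cE cJ].
apply: WP; first by rewrite -bE -cE !mulrA idem -!mulrA idem.
case/orP: bJ => [/andP[/eqP tpr ltpr]|bJ]; last by rewrite jacobsonMr ?orbT.
case/orP: cJ => [/andP[/eqP trq ltrq]|cJ]; last by rewrite jacobsonMl ?orbT.
by rewrite (leq_ltn_trans ltpr ltrq) andbT; apply/orP; left; apply/eqP; rewrite tpr.
Qed.

Lemma idempotent_rad_entry p q : tag p = tag q -> (tagged p < tagged q)%N ->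
  e (tag p) \in rad_entry e p q.
Proof. by move=> tpq ltpq; apply/(mem_rad_entry he); rewrite ltpq -tpq eqxx !idem. Qed.

Lemma rad2_entry_sub p q : (rad2_entry e p q <= rad_entry e p q)%VS.
Proof.
apply/subvP => a /mem_rad2_entry[aE aJ]; apply/(mem_rad_entry he); split=> //.
by case/orP: aJ => [/andP[-> /ltnW->]|->]; rewrite ?orbT.
Qed.

(** Unless [p] is last in its block, entries factor through the successor
    [r] of [p], the left factor being the idempotent; unless [q] is first in
    its block, they factor through the predecessor of [q]. *)
Lemma rad2_entry_eq p q :
  ~~ consecutive p q -> ~~ last_first p q -> rad2_entry e p q = rad_entry e p q.
Proof.
move=> nc nlf; apply/eqP; rewrite eqEsubv rad2_entry_sub; apply/subvP => a.
(* A strict step inside a block that is not between neighbours has length at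
   least two. *)
have jump : (tag p == tag q) && (tagged p < tagged q)%N ->
    (tag p == tag q) && ((tagged p).+1 < tagged q)%N.
  move=> /andP[tpq ltpq]; rewrite tpq ltn_neqAle ltpq andbT /= eq_sym.
  by move: nc; rewrite /consecutive tpq.
move=> /(mem_rad_entry he)[aE aJ].
have {}aJ : (tag p == tag q) && ((tagged p).+1 < tagged q)%N || (a \in J).
  by case/orP: aJ => [/jump->|->]; rewrite ?orbT.
have ea := peirce_mull aE (idem _).
have ae := peirce_mulr aE (idem _).
have [lp|nlp] := ltnP (tagged p).+1 (n (tag p)).
  pose r : block_index n := Tagged (fun i => 'I_(n i)) (Ordinal lp).
  rewrite memvE (subv_trans _ (sumv_sup r isT (subvv _))) // -memvE -ea memv_mul //.
    exact: (@idempotent_rad_entry p r).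
  by apply/(mem_rad_entry he).
have [q0|q0] := posnP (tagged q).
  case/negP: nlf; rewrite /last_first q0 eqxx andbT eqn_leq -ltnS prednK.
    by rewrite ltn_ord /= -ltnS prednK // (leq_ltn_trans _ (ltn_ord (tagged p))).
  by rewrite (leq_ltn_trans _ (ltn_ord (tagged p))).
have lq : ((tagged q).-1 < n (tag q))%N.
  by rewrite (leq_ltn_trans (leq_pred _)) ?ltn_ord.
pose r : block_index n := Tagged (fun i => 'I_(n i)) (Ordinal lq).
rewrite memvE (subv_trans _ (sumv_sup r isT (subvv _))) // -memvE -ae memv_mul //.
  by apply/(mem_rad_entry he); rewrite /= ltn_predRL.
by apply: (@idempotent_rad_entry r q) => //=; rewrite prednK.
Qed.

Lemma rad_entry_consecutive p q : consecutive p q ->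
  rad_entry e p q = corner (e (tag p)) fullv (e (tag p)).
Proof. by case/andP=> /eqP tpq /eqP q1; rewrite /rad_entry q1 ltnSn -tpq eqxx. Qed.

(** Nothing lies strictly between [p] and [q], so one factor of any product is
    in [J(R)]; conversely [a = a e_i] with [a] at [(p, p)] and [e_i] at
    [(p, q)]. *)
Lemma rad2_entry_consecutive p q : consecutive p q ->
  rad2_entry e p q = corner (e (tag p)) J (e (tag p)).
Proof.
case/andP=> /eqP tpq /eqP q1; apply/eqP; rewrite eqEsubv; apply/andP.
split; apply/subvP => a.
  by case/mem_rad2_entry; rewrite q1 ltnn andbF -tpq => aE aJ; apply/mem_corner_jacobson.
case/mem_corner_jacobson=> // aJ aE.
have ae := peirce_mulr aE (idem _).
rewrite memvE (subv_trans _ (sumv_sup p isT (subvv _))) // -memvE -ae memv_mul //.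
  by apply/(mem_rad_entry he); rewrite aJ orbT.
by apply: idempotent_rad_entry; rewrite // q1.
Qed.

Lemma rad_entry_last_first p q : last_first p q ->
  rad_entry e p q = corner (e (tag p)) J (e (tag q)).
Proof. by case/andP=> _ /eqP q0; rewrite /rad_entry q0 ltn0 andbF. Qed.

(** No index follows [p] or precedes [q] in its block, so both factors of a
    product are in [J(R)].  Conversely the unit of [R] is the sum of the [e_k],
    so [e_i u v e_s] is the sum over [k] of [(e_i u e_k) (e_k v e_s)], and each
    [e_k] is available at the first vertex of block [k]. *)
Lemma rad2_entry_last_first p q : last_first p q ->
  rad2_entry e p q = corner (e (tag p)) (J * J)%VS (e (tag q)).
Proof.
move=> /andP[/eqP lp /eqP q0]; apply/eqP; rewrite eqEsubv; apply/andP; split.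
  apply/subv_sumP => r _; apply/prodvP => b c.
  move=> /(mem_rad_entry he)[bE bJ] /(mem_rad_entry he)[cE cJ].
  have {}bJ : b \in J.
    case/orP: bJ => // /andP[/eqP tpr]; have npr : n (tag p) = n (tag r) by rewrite tpr.
    by rewrite lp npr ltnNge -ltnS prednK ?ltn_ord.
  have {}cJ : c \in J by move: cJ; rewrite q0 ltn0 andbF.
  apply/mem_corner_jacobson2 => //; split; first by rewrite memv_mul.
  by rewrite -bE -cE !mulrA idem -!mulrA idem.
apply/subvP => x /mem_corner_jacobson2[] // xJ <-.
suff /subvP sub : (J * J <= (amulr (e (tag q)) \o amull (e (tag p))) @^-1: rad2_entry e p q)%VS.
  by move/sub: xJ; rewrite -memv_preim !lfun_simp.
apply/prodvP => u v uJ vJ; rewrite -memv_preim !lfun_simp /=.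
have -> : e (tag p) * (u * v) * e (tag q) =
    \sum_k e (tag p) * u * e k * (e k * v * e (tag q)).
  under eq_bigr => k _ do rewrite -[e k * v * _]mulrA mulrA -[_ * e k * e k]mulrA idem.
  rewrite -mulr_suml -mulr_sumr; have [_ _ ->] := he.
  by rewrite mulr1 !mulrA.
apply: rpred_sum => k _.
pose r : block_index n := Tagged (fun i => 'I_(n i)) (Ordinal (hn k)).
rewrite memvE (subv_trans _ (sumv_sup r isT (subvv _))) // -memvE memv_mul //.
  apply/(mem_rad_entry he); rewrite /= !mulrA idem -!mulrA idem; split=> //.
  by rewrite jacobsonMl ?jacobsonMr ?orbT.
apply/(mem_rad_entry he); rewrite /= !mulrA idem -!mulrA idem; split=> //.
by rewrite jacobsonMl ?jacobsonMr ?orbT.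
Qed.

(** * Counting the arrows of the block quiver *)

Lemma consecutive_not_last_first p q : consecutive p q -> ~~ last_first p q.
Proof. by case/andP=> _ /eqP q1; rewrite /last_first q1 andbF. Qed.

Lemma consecutive_inj p q q' : consecutive p q -> consecutive p q' -> q = q'.
Proof.
case/andP=> [/eqP tpq /eqP eq] /andP[/eqP tpq' /eqP eq'].
by apply: block_index_eq; [rewrite -tpq | rewrite eq].
Qed.

Variable d : 'I_m -> 'I_m -> nat.
Local Notation source := (@block_source m n hn d).
Local Notation target := (@block_target m n hn d).

Lemma consecutive_inl u : consecutive (source (inl u)) (target (inl u)).
Proof. by case: u => i j; rewrite /consecutive /= !eqxx. Qed.

Lemma last_first_inr v : last_first (source (inr v)) (target (inr v)).
Proof. by case: v => -[i s] k; rewrite /last_first /= !eqxx. Qed.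

Lemma source_inl_inj u u' : source (inl u) = source (inl u') -> u = u'.
Proof.
case: u u' => [i j] [i' j'] uu'; apply: (@block_index_eq m (fun i => (n i).-1)) => /=.
  exact: (congr1 tag uu').
exact: (congr1 (fun p : block_index n => nat_of_ord (tagged p)) uu').
Qed.

Definition arrows_between p q : {set block_arrow n d} :=
  [set a | (source a == p) && (target a == q)].

(** A chain arrow is determined by its source, and a chain arrow starts at
    every vertex that is not last in its block. *)
Lemma card_arrows_consecutive p q : consecutive p q -> #|arrows_between p q| = 1%N.
Proof.
move=> cpq; have [tpq sq] := andP cpq; have nq : (tagged p < (n (tag p)).-1)%N.
  have := ltn_ord (tagged q); rewrite (eqP sq) ltn_predRL.
  by have -> : n (tag q) = n (tag p) by rewrite (eqP tpq).
pose u0 : {i : 'I_m & 'I_(n i).-1} := Tagged (fun i => 'I_((n i).-1)) (Ordinal nq).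
have su0 : source (inl u0) = p by apply: block_index_eq.
rewrite -(cards1 (inl u0 : block_arrow n d)); apply: eq_card => a; rewrite !inE.
apply/andP/eqP => [[/eqP sa /eqP ta]|->]; last first.
  rewrite su0 eqxx; split=> //; apply/eqP/(consecutive_inj (p := p)) => //.
  by rewrite -{1}su0 consecutive_inl.
case: a sa ta => [u|v] sa ta; first by congr inl; apply: source_inl_inj; rewrite sa.
by have := last_first_inr v; rewrite sa ta (negPf (consecutive_not_last_first cpq)).
Qed.

Lemma card_arrows_last_first p q :
  last_first p q -> #|arrows_between p q| = d (tag p) (tag q).
Proof.
move=> lf; pose g (k : 'I_(d (tag p) (tag q))) : block_arrow n d :=
  inr (Tagged (fun st => 'I_(d st.1 st.2)) (k : 'I_(d (tag p, tag q).1 (tag p, tag q).2))).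
have g_inj : injective g.
  (* Comparing numerical values avoids equations between dependent pairs. *)
  pose val_inr (a : block_arrow n d) : nat := if a is inr (existT _ k) then k else 0%N.
  by move=> k k' /(congr1 val_inr) /val_inj.
have [/eqP lp /eqP q0] := andP lf.
have -> : arrows_between p q = g @: setT.
  apply/setP => a; rewrite inE; apply/andP/imsetP => [[/eqP sa /eqP ta]|[k _ ->]]; last first.
    by split; apply/eqP/block_index_eq; rewrite //= ?lp ?q0.
  case: a sa ta => [u|[[i s] k]] sa ta.
    by have /consecutive_not_last_first := consecutive_inl u; rewrite sa ta lf.
  have ip : i = tag p := congr1 tag sa; have sq : s = tag q := congr1 tag ta.
  by rewrite /g; case: _ / ip; case: _ / sq; exists k.
by rewrite card_imset // cardsT card_ord.
Qed.

Lemma card_arrows_other p q :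
  ~~ consecutive p q -> ~~ last_first p q -> #|arrows_between p q| = 0%N.
Proof.
move=> nc nlf; apply/eqP; rewrite cards_eq0; apply/eqP/setP => a; rewrite !inE.
apply/andP => -[/eqP sa /eqP ta]; case: a sa ta => [u|v] sa ta.
  by have := consecutive_inl u; rewrite sa ta (negPf nc).
by have := last_first_inr v; rewrite sa ta (negPf nlf).
Qed.

End Arrows.

Theorem theorem3p1 (K : closedFieldType) (R : falgType K) (m : nat)
  (e : 'I_m -> R)
  (he : complete_primitive_idempotents e) (hb : basic e)
  (n : 'I_m -> nat) (hn : forall i : 'I_m, 0 < n i) :
  is_quiver_of (block_quiver hn (num_arrows e)) (block_idempotent he hb hn).
Proof.
have prim i : primitive_idempotent (e i) by case: he.
have idem i : GRing.mul (e i) (e i) = e i by case: (prim i).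
split=> [||p q]; [exact: block_complete | exact: block_basic |].
rewrite (block_num_arrows he hb hn).
have [c|nc] := boolP (consecutive p q).
  rewrite [LHS](card_arrows_consecutive _ _ c).
  rewrite rad_entry_consecutive // rad2_entry_consecutive //.
  by rewrite dim_corner_residue // subSnn.
have [lf|nlf] := boolP (last_first p q).
  rewrite [LHS](card_arrows_last_first _ _ lf).
  by rewrite num_arrowsE // rad_entry_last_first ?rad2_entry_last_first.
by rewrite [LHS](card_arrows_other _ _ nc nlf) (rad2_entry_eq he) ?subnn.
Qed.
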